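(* Let $\mathcal{Q}$ be a smooth manifold, let $E$ be a Morse family on the total space of a fiber bundle $\tau:\mathcal{P}\to\mathcal{T}^*\mathcal{Q}$, with bundle coordinates $(q^i,p_i,z,\lambda^a)$ on $\mathcal{P}$, and let $\mathcal{N}_E\subset\mathcal{T}\mathcal{T}^*\mathcal{Q}$ be the Legendrian submanifold generated by $E$ (implicit contact Hamiltonian dynamics). Let $\gamma:\mathcal{Q}\times\mathbb{R}\to\mathcal{T}^*\mathcal{Q}$ be a section of $\rho:\mathcal{T}^*\mathcal{Q}\to\mathcal{Q}\times\mathbb{R}$ of the form $\gamma(q,z)=(\hat\gamma(q),z)$ with $\hat\gamma=\hat\gamma_i(q)\,dq^i$ a closed one-form on $\mathcal{Q}$, and let $\mathcal{N}_E|_{\mathrm{im}(\gamma)}\subset\mathcal{T}\mathcal{T}^*\mathcal{Q}$ and $\mathcal{N}_E^\gamma\subset T(\mathcal{Q}\times\mathbb{R})$ be the associated restricted and projected sets. Then the following two conditions are equivalent: 1. $\mathcal{N}_E$ and $\mathcal{N}_E^\gamma$ are $\gamma$-related, that is, $$\big(T\gamma(\mathcal{N}_E^\gamma),\mathcal{R}(E)\big)=\mathcal{N}_E|_{\mathrm{im}(\gamma)},$$ where the left-hand side denotes the set of pairs $(T\gamma(v),\mathcal{R}(E)|_{(q,\hat\gamma(q),z,\lambda)})\in T\mathcal{T}^*\mathcal{Q}\times\mathbb{R}$, with $(q,z,\lambda)$ ranging over all points at which $\frac{\partial E}{\partial\lambda^a}(q,\hat\gamma(q),z,\lambda)=0$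 for all $a$, and $v\in\mathcal{N}_E^\gamma$ the element corresponding to $(q,z,\lambda)$. 2. The equation $$d(E\circ\gamma)=\gamma^*\big(\mathcal{R}(E)\,\eta_{\mathcal{Q}}\big)$$ holds at all points $(q,z,\lambda)$ with $\frac{\partial E}{\partial\lambda^a}(q,\hat\gamma(q),z,\lambda)=0$ for all $a$, where $(E\circ\gamma)(q,z,\lambda)=E(q^i,\hat\gamma_i(q),z,\lambda^a)$, and $\gamma^*(\mathcal{R}(E)\eta_{\mathcal{Q}})$ is the one-form $\frac{\partial E}{\partial z}(q,\hat\gamma(q),z,\lambda)\,(dz-\hat\gamma_i(q)\,dq^i)$ in the variables $(q,z,\lambda)$.
   Context: $\mathcal{T}^*\mathcal{Q}=T^*\mathcal{Q}\times\mathbb{R}$ carries the contact form $\eta_{\mathcal{Q}}=dz-p_i\,dq^i$ in Darboux coordinates $(q^i,p_i,z)$, with Reeb field $\mathcal{R}=\partial/\partial z$; $\mathcal{R}(E)=\partial E/\partial z$. The map $\rho:\mathcal{T}^*\mathcal{Q}\to\mathcal{Q}\times\mathbb{R}$ is $\rho(w,z)=(\pi_{\mathcal{Q}}(w),z)$. The extended tangent bundle is $\mathcal{T}\mathcal{T}^*\mathcal{Q}=T\mathcal{T}^*\mathcal{Q}\times\mathbb{R}$, with coordinates $(q^i,p_i,z,\dot q^i,\dot p_i,\dot z,u)$, and it is a contact manifold with contact form $d\dot z+u\,dz-(\dot p_i+u p_i)\,dq^i-p_i\,d\dot q^i$. A Legendrian submanifold of a contact manifold of dimension $2m+1$ is an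 $m$-dimensional submanifold on which the contact form vanishes. A Morse family on a fiber bundle $\tau:\mathcal{P}\to\mathcal{M}$ is a function $E:\mathcal{P}\to\mathbb{R}$ such that $T_w\,\mathrm{im}(dE)+T_wV^0\mathcal{P}=T_wT^*\mathcal{P}$ for all $w\in\mathrm{im}(dE)\cap V^0\mathcal{P}$, where $V^0\mathcal{P}\subset T^*\mathcal{P}$ consists of the covectors annihilating the vertical bundle $\ker T\tau$. The Legendrian submanifold of $\mathcal{T}\mathcal{T}^*\mathcal{Q}$ generated by $E$ is $$\mathcal{N}_E=\Big\{\big(q^i,p_i,z,\tfrac{\partial E}{\partial p_i},-\tfrac{\partial E}{\partial q^i}-p_i\tfrac{\partial E}{\partial z},p_i\tfrac{\partial E}{\partial p_i}-E,\tfrac{\partial E}{\partial z}\big):\tfrac{\partial E}{\partial\lambda^a}=0\Big\},$$ with $E$ and its derivatives evaluated at $(q,p,z,\lambda)$. Write $|_{\mathrm{im}(\gamma)}$ for evaluation at $p_i=\hat\gamma_i(q)$, i.e. at $(q,\hat\gamma(q),z,\lambda)$. The restriction of $\mathcal{N}_E$ to the image of $\gamma$ is $$\mathcal{N}_E|_{\mathrm{im}(\gamma)}=\Big\{\big(q^i,\hat\gamma_i,z,\tfrac{\partial E}{\partial p_i},-\tfrac{\partial E}{\partial q^i}-\hat\gamma_i\tfrac{\partial E}{\partial z},\hat\gamma_i\tfrac{\partial E}{\partial p_i}-E,\tfrac{\partial E}{\partial z}\big)\Big|_{\mathrm{im}(\gamma)}:\tfrac{\partial E}{\partial\lambda^a}\Big|_{\mathrm{im}(\gamma)}=0\Big\},$$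 and its image under $\psi:\mathcal{T}\mathcal{T}^*\mathcal{Q}\to T(\mathcal{Q}\times\mathbb{R})$, $\psi(W,u)=T\rho(W)$, is $$\mathcal{N}_E^\gamma=\Big\{\big(q^i,z;\dot q^i,\dot z\big)=\big(q^i,z;\tfrac{\partial E}{\partial p_i},\hat\gamma_i\tfrac{\partial E}{\partial p_i}-E\big)\Big|_{\mathrm{im}(\gamma)}:\tfrac{\partial E}{\partial\lambda^a}\Big|_{\mathrm{im}(\gamma)}=0\Big\};$$ the element of $\mathcal{N}_E^\gamma$ corresponding to $(q,z,\lambda)$ is the one displayed. *)

(* Defs.v *)
From HB Require Import structures.
From mathcomp Require Import all_boot all_order all_algebra.
From mathcomp Require Import all_classical all_reals all_analysis.
Import Order.TTheory GRing.Theory Num.Theory.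
Import numFieldNormedType.Exports.

Set Implicit Arguments.
Unset Strict Implicit.
Unset Printing Implicit Defensive.

Local Open Scope classical_set_scope.
Local Open Scope ring_scope.

(** * Calculus on open subsets of a normed space *)

Section Calculus.
Context {R : realType}.

(* For D open in a finite-dimensional space this is the class C^r on D:
   fixing the direction v turns the derivative into a W-valued function. *)
Fixpoint classC (r : nat) (V W : normedModType R) (D : set V) (f : V -> W)
    : Prop :=
  match r with
  | 0 => forall x, D x -> {for x, continuous f}
  | r'.+1 => (forall x, D x -> differentiable f x) /\
             (forall v, classC r' D (fun x => 'd f x v))
  end.

Definition smooth_on (V W : normedModType R) (D : set V) (f : V -> W) :=
  forall r, classC r D f.

Definition dotv n (u v : 'rV[R]_n) : R := \sum_j u 0 j * v 0 j.

Definition grad n (F : 'rV[R]_n -> R) (y : 'rV[R]_n) : 'rV[R]_n :=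
  \row_j 'd (F : 'rV[R]_n -> R^o) y (delta_mx 0 j).

End Calculus.

(** * Charts and atlases *)

Section Charts.
Context {R : realType}.

Record chart (T : Type) (n : nat) := Chart {
  cdom : set T ;
  cmap : T -> 'rV[R]_n
}.

Definition cran T n (c : chart T n) : set 'rV[R]_n := cmap c @` cdom c.

(* f \o c^-1 on the range of c, and 0 elsewhere. *)
Definition in_chart T n (c : chart T n) (V : normedModType R) (f : T -> V)
    (y : 'rV[R]_n) : V :=
  xget 0 (f @` [set x | cdom c x /\ cmap c x = y]).

Definition is_chart T n (c : chart T n) :=
  (forall x y, cdom c x -> cdom c y -> cmap c x = cmap c y -> x = y) /\
  open (cran c).

Definition smooth_transition T n (c d : chart T n) :=
  open (cmap c @` (cdom c `&` cdom d)) /\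
  smooth_on (cmap c @` (cdom c `&` cdom d)) (in_chart c (cmap d)).

(* A set with a family of charts; that the family is a smooth atlas is the
   predicate [manifold] below. *)
Record charted (n : nat) := Charted {
  pt :> Type ;
  cidx : Type ;
  atlas : cidx -> chart pt n
}.

Definition mtop n (M : charted n) : Type := M.

End Charts.

Arguments chart : clear implicits.
Arguments charted : clear implicits.
Arguments mtop {R n} M.

(* The manifold topology, generated by the preimages of open sets under the
   charts. *)
Section AtlasTopology.
Context {R : realType} {n : nat} (M : charted R n).

Definition chart_open : set (set M) :=
  [set A | exists i, exists2 O : set 'rV[R]_n,
     open O & A = cdom (atlas i) `&` cmap (atlas i) @^-1` O].

HB.instance Definition _ := gen_eqMixin (mtop M).
HB.instance Definition _ := gen_choiceMixin (mtop M).
HB.instance Definition _ :=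
  @isSubBaseTopological.Build (mtop M) (set M) chart_open id.

End AtlasTopology.

Section Manifolds.
Context {R : realType}.

Definition manifold n (M : charted R n) :=
  [/\ forall i, is_chart (atlas i : chart R M n),
      forall x : M, exists i, cdom (atlas i) x,
      forall i j, smooth_transition (atlas i : chart R M n) (atlas j),
      hausdorff_space (mtop M)
    & @second_countable (mtop M)].

(* The charts of the maximal atlas. *)
Definition maximal_atlas n (M : charted R n) : set (chart R M n) :=
  [set c | is_chart c /\
     forall i, smooth_transition c (atlas i) /\ smooth_transition (atlas i) c].

Definition smooth_fun n (M : charted R n) (f : M -> R) :=
  forall i, smooth_on (cran (atlas i)) (in_chart (atlas i) (f : M -> R^o)).

(* Continuity is built in, through f @^-1` cdom (atlas j). *)
Definition smooth_map m n (M : charted R m) (N : charted R n) (A : set M)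
    (f : M -> N) :=
  forall x, A x -> forall i j,
    cdom (atlas i) x -> cdom (atlas j) (f x) ->
    exists D, [/\ open D, D (cmap (atlas i) x),
      D `<=` cmap (atlas i) @` (cdom (atlas i) `&` f @^-1` cdom (atlas j))
    & smooth_on D (in_chart (atlas i) (cmap (atlas j) \o f))].

(** * Products *)

Definition prod_chart T U m n (c : chart R T m) (d : chart R U n) :
    chart R (T * U) (m + n) :=
  Chart (cdom c `*` cdom d) (fun x => row_mx (cmap c x.1) (cmap d x.2)).

Definition prodM m n (M : charted R m) (N : charted R n) : charted R (m + n) :=
  @Charted R (m + n) (M * N) (cidx M * cidx N)
    (fun ij => prod_chart (atlas ij.1) (atlas ij.2)).

Definition lineM : charted R 1 :=
  @Charted R 1 R unit (fun=> Chart setT (fun z => const_mx z)).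

(** * Tangent and cotangent bundles *)

(* A tangent vector is its base point together with its components in all the
   charts around that point, subject to the transformation law; the components
   in the other charts are set to 0 so that equality is Leibniz equality. *)
Record tangent n (M : charted R n) := Tangent {
  tbase : M ;
  tcomp : cidx M -> 'rV[R]_n ;
  _ : forall i, ~ cdom (atlas i) tbase -> tcomp i = 0 ;
  _ : forall i j, cdom (atlas i) tbase -> cdom (atlas j) tbase ->
      tcomp j =
      'd (in_chart (atlas i) (cmap (atlas j))) (cmap (atlas i) tbase) (tcomp i)
}.

Record covector n (M : charted R n) := Covector {
  cbase : M ;
  ccomp : cidx M -> 'rV[R]_n ;
  _ : forall i, ~ cdom (atlas i) cbase -> ccomp i = 0 ;
  _ : forall i j, cdom (atlas i) cbase -> cdom (atlas j) cbase -> forall v,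
      dotv (ccomp i) v =
      dotv (ccomp j)
        ('d (in_chart (atlas i) (cmap (atlas j))) (cmap (atlas i) cbase) v)
}.

Definition cot_chart n (M : charted R n) (i : cidx M) :
    chart R (covector M) (n + n) :=
  Chart [set a | cdom (atlas i) (cbase a)]
        (fun a => row_mx (cmap (atlas i) (cbase a)) (ccomp a i)).

Definition cotM n (M : charted R n) : charted R (n + n) :=
  @Charted R (n + n) (covector M) (cidx M) (@cot_chart n M).

(* W = Tf(V) *)
Definition tangent_map m n (M : charted R m) (N : charted R n) (f : M -> N)
    (V : tangent M) (W : tangent N) :=
  tbase W = f (tbase V) /\
  forall i j, cdom (atlas i) (tbase V) -> cdom (atlas j) (f (tbase V)) ->
    tcomp W j = 'd (in_chart (atlas i) (cmap (atlas j) \o f))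
                   (cmap (atlas i) (tbase V)) (tcomp V i).

(* V is the point of TM with coordinates (x, v) in the chart of index i. *)
Definition tangent_coords n (M : charted R n) (V : tangent M) (i : cidx M)
    (x v : 'rV[R]_n) :=
  [/\ cdom (atlas i) (tbase V), cmap (atlas i) (tbase V) = x & tcomp V i = v].
Arguments tangent_coords {n} M.

(* The tangent space at w of a submanifold S: velocities of curves in S. *)
Definition tangent_to n (M : charted R n) (S : set M) (w : M) :
    set (tangent M) :=
  [set W | exists c : lineM -> M,
     [/\ smooth_map setT c, forall t, S (c t), c 0 = w, tbase W = w
       & forall j, cdom (atlas j) w ->
           tcomp W j = 'D_1 ((cmap (atlas j) \o c) : R -> 'rV[R]_n) 0]].

(** * One-forms *)

Definition one_form n (Q : charted R n) (g : Q -> covector Q) :=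
  (forall q, cbase (g q) = q) /\ smooth_map (N := cotM Q) setT g.

Definition local_form n (Q : charted R n) (g : Q -> covector Q) (i : cidx Q) :
    'rV[R]_n -> 'rV[R]_n :=
  in_chart (atlas i) (fun q => ccomp (g q) i).

(* In each chart, d_i g_j = d_j g_i. *)
Definition closed_form n (Q : charted R n) (g : Q -> covector Q) :=
  forall i y, cran (atlas i) y -> forall u v,
    dotv ('d (local_form g i) y u) v = dotv ('d (local_form g i) y v) u.

(** * Fiber bundles and Morse families *)

Definition fiber_bundle b k (P : charted R (b + k)) (B : charted R b)
    (tau : P -> B) :=
  [/\ manifold P, smooth_map setT tau, (forall x, exists w, tau w = x)
    & exists2 F : charted R k, manifold F &
      forall x : B, exists (U : set (mtop B)) (h : P -> F) (s : prodM B F -> P),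
        [/\ open U /\ U x,
            smooth_map (M := P) (N := prodM B F) (tau @^-1` U)
              (fun w => (tau w, h w)),
            smooth_map (M := prodM B F) (N := P) (U `*` setT) s,
            forall w, U (tau w) -> s (tau w, h w) = w
          & forall y f, U y -> tau (s (y, f)) = y /\ h (s (y, f)) = f]].

Definition im_differential n (P : charted R n) (E : P -> R) : set (cotM P) :=
  [set a : covector P | forall i, cdom (atlas i) (cbase a) ->
     ccomp a i = grad (in_chart (atlas i) (E : P -> R^o))
                      (cmap (atlas i) (cbase a))].

Definition vertical m n (P : charted R m) (B : charted R n) (tau : P -> B)
    (V : tangent P) :=
  forall i j, cdom (atlas i) (tbase V) -> cdom (atlas j) (tau (tbase V)) ->
    'd (in_chart (atlas i) (cmap (atlas j) \o tau))
       (cmap (atlas i) (tbase V)) (tcomp V i) = 0.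

(* The conormal bundle V^0 P. *)
Definition vertical_annihilator m n (P : charted R m) (B : charted R n)
    (tau : P -> B) : set (cotM P) :=
  [set a : covector P | forall V : tangent P, tbase V = cbase a ->
     vertical tau V ->
     forall i, cdom (atlas i) (cbase a) -> dotv (ccomp a i) (tcomp V i) = 0].

Definition morse_family m n (P : charted R m) (B : charted R n) (tau : P -> B)
    (E : P -> R) :=
  smooth_fun E /\
  forall w, im_differential E w -> vertical_annihilator tau w ->
  forall W : tangent (cotM P), tbase W = w ->
  exists W1 W2,
    [/\ tangent_to (im_differential E) w W1,
        tangent_to (vertical_annihilator tau) w W2
      & forall i, tcomp W i = tcomp W1 i + tcomp W2 i].

(** * Contact setting *)

(* The manifold T^*Q x R, with Darboux charts (q, p, z). *)
Definition contactM n (Q : charted R n) : charted R (n + n + 1) :=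
  prodM (cotM Q) lineM.

Definition darboux n (Q : charted R n) (i : cidx Q) :
    chart R (contactM Q) (n + n + 1) :=
  @atlas R (n + n + 1) (contactM Q) (i, tt).

(* The section (q, z) |-> (g(q), z) of rho. *)
Definition gamma n (Q : charted R n) (g : Q -> covector Q) :
    prodM Q lineM -> contactM Q :=
  fun x => (g x.1, x.2).

(* Blocks of (q, p, z, lambda). *)
Section Blocks.
Context {n k : nat}.
Implicit Types y : 'rV[R]_(n + n + 1 + k).
Definition qpzpart y : 'rV[R]_(n + n + 1) := lsubmx y.
Definition qpart y : 'rV[R]_n := lsubmx (lsubmx (lsubmx y)).
Definition ppart y : 'rV[R]_n := rsubmx (lsubmx (lsubmx y)).
Definition zpart y : R := rsubmx (lsubmx y) 0 0.
Definition lpart y : 'rV[R]_k := rsubmx y.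

Variable F : 'rV[R]_(n + n + 1 + k) -> R.
Definition partial_q y := qpart (grad F y).
Definition partial_p y := ppart (grad F y).
Definition partial_z y := zpart (grad F y).
Definition partial_l y := lpart (grad F y).
End Blocks.

Section Dynamics.
Context {n k : nat} (Q : charted R n) (P : charted R (n + n + 1 + k)).
Variables (tau : P -> contactM Q) (E : P -> R) (g : Q -> covector Q).

(* c is a system of bundle coordinates (q, p, z, lambda) on P, over the Darboux
   coordinates given by the chart of index i of Q. *)
Definition bundle_chart (i : cidx Q) (c : chart R P (n + n + 1 + k)) :=
  maximal_atlas c /\
  forall w, cdom c w ->
    cdom (darboux i) (tau w) /\
    qpzpart (cmap c w) = cmap (darboux i) (tau w).

Definition localE (c : chart R P (n + n + 1 + k)) :
    'rV[R]_(n + n + 1 + k) -> R :=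
  in_chart c (E : P -> R^o).

(* The Reeb derivative R(E). *)
Definition reeb (c : chart R P (n + n + 1 + k)) := partial_z (localE c).

(* The submanifold N_E of the extended tangent bundle. *)
Definition legendrian : set (tangent (contactM Q) * R) :=
  [set X | exists i c y,
     [/\ bundle_chart i c, cran c y, partial_l (localE c) y = 0,
         tangent_coords (contactM Q) X.1 (i, tt) (qpzpart y)
           (row_mx
             (row_mx (partial_p (localE c) y)
                (- partial_q (localE c) y - partial_z (localE c) y *: ppart y))
             (const_mx (dotv (ppart y) (partial_p (localE c) y) - localE c y)))
       & X.2 = partial_z (localE c) y]].

(* N_E restricted to im(gamma). *)
Definition legendrian_restr : set (tangent (contactM Q) * R) :=
  [set X | legendrian X /\ exists x, tbase X.1 = gamma g x].

(* (q, z, lambda) |-> (q, g(q), z, lambda) *)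
Definition lift_gamma (i : cidx Q) (x : 'rV[R]_(n + 1 + k)) :
    'rV[R]_(n + n + 1 + k) :=
  let q := lsubmx (lsubmx x) in
  row_mx (row_mx (row_mx q (local_form g i q)) (rsubmx (lsubmx x))) (rsubmx x).

(* (q, z, lambda) are the coordinates, in the bundle chart c, of a point over
   im(gamma) at which dE/dlambda = 0. *)
Definition critical (i : cidx Q) (c : chart R P (n + n + 1 + k))
    (x : 'rV[R]_(n + 1 + k)) :=
  [/\ bundle_chart i c, cran c (lift_gamma i x)
    & partial_l (localE c) (lift_gamma i x) = 0].

(* V is the element of N_E^gamma corresponding to (q, z, lambda). *)
Definition projected_at (i : cidx Q) (c : chart R P (n + n + 1 + k))
    (x : 'rV[R]_(n + 1 + k)) (V : tangent (prodM Q lineM)) :=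
  let y := lift_gamma i x in
  tangent_coords (prodM Q lineM) V (i, tt) (lsubmx x)
    (row_mx (partial_p (localE c) y)
       (const_mx (dotv (ppart y) (partial_p (localE c) y) - localE c y))).

Definition projected : set (tangent (prodM Q lineM)) :=
  [set V | exists i c x, critical i c x /\ projected_at i c x V].

(* The set (T gamma (N_E^gamma), R(E)). *)
Definition image_projected : set (tangent (contactM Q) * R) :=
  [set X | exists i c x V,
     [/\ critical i c x, projected V, projected_at i c x V,
         tangent_map (gamma g) V X.1 & X.2 = reeb c (lift_gamma i x)]].

Definition gamma_related := image_projected = legendrian_restr.

Definition pulled_E (i : cidx Q) (c : chart R P (n + n + 1 + k)) :
    'rV[R]_(n + 1 + k) -> R :=
  localE c \o lift_gamma i.

(* gamma^*(R(E) eta_Q) = dE/dz (dz - g_i dq^i), at x applied to v. *)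
Definition pulled_contact_form (i : cidx Q) (c : chart R P (n + n + 1 + k))
    (x v : 'rV[R]_(n + 1 + k)) : R :=
  reeb c (lift_gamma i x) *
  (rsubmx (lsubmx v) 0 0
   - dotv (local_form g i (lsubmx (lsubmx x))) (lsubmx (lsubmx v))).

End Dynamics.

End Manifolds.

(* Main.v *)
(** In bundle coordinates T gamma of the vector (E_p, gamma.E_p - E) is
    (E_p, d gamma(E_p), gamma.E_p - E), so it lies in N_E over the same critical
    point exactly when d gamma(E_p) = - E_q - E_z gamma.  The z- and
    lambda-components of d(E o gamma) and gamma^*(R(E) eta) agree at every
    critical point, and since d gamma is symmetric (gamma is closed) the
    q-components agree exactly under that same condition.  The sets being
    coordinate-free, a tangent vector given in one chart has to be extended to
    all others, which uses the cocycle identity of the transitions of T*Q. *)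
Require Import Defs.
From mathcomp Require Import all_boot all_order all_algebra.
From mathcomp Require Import all_classical all_reals all_analysis.
Import GRing.Theory Num.Theory.
Import numFieldNormedType.Exports.

Set Implicit Arguments.
Unset Strict Implicit.
Unset Printing Implicit Defensive.

Local Open Scope classical_set_scope.
Local Open Scope ring_scope.

(** * Differentials of maps between row-vector spaces and the pairing [dotv] *)

Section Calculus.
Context {R : realType}.

Lemma is_diffE (V W : normedModType R) (f df : V -> W) x v :
  is_diff x f df -> 'd f x v = df v.
Proof.
by move=> fdf; exact: (congr1 (@^~ v) (diff_val (is_diff_def := fdf))).
Qed.

(** The little-o remainders of f and g agree near 0, and uniqueness of the differential does the
    rest. Functions read through [in_chart] match a usable formula only near a point, so most
    differentials below are obtained this way. *)
Lemma near_is_diff (V W : normedModType R) (f g df : V -> W) (x : V) :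
  (\forall y \near x, f y = g y) -> is_diff x f df -> is_diff x g df.
Proof.
move=> fg fdf.
have gx : g x = f x by rewrite (nbhs_singleton fg).
have dfc : continuous ('d f x) by apply: diff_continuous.
have gdf : g \o shift x = cst (g x) + 'd f x +o_ 0 id.
  have /diff_locally : differentiable f x by [].
  move=> /eqaddoP fo; apply/eqaddoP => _/posnumP[e].
  have fg' : \forall h \near 0, f (h + x) = g (h + x).
    by move: fg; rewrite (near_shift 0) /=; apply: filterS => h; rewrite subr0.
  near=> h.
  have fgh : f (h + x) = g (h + x) by near: h.
  have -> : (g \o shift x - (cst (g x) + 'd f x)) h =
      (f \o shift x - (cst (f x) + 'd f x)) h.
    by rewrite !fctE /= fgh gx.
  by near: h; apply: fo.
have dgE : 'd g x = 'd f x :> (V -> W) by apply: diff_unique.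
by apply: DiffDef; [apply/diff_locallyP; rewrite dgE|rewrite dgE diff_val].
Unshelve. all: by end_near. Qed.

Lemma near_differentiable (V W : normedModType R) (f g : V -> W) (x : V) :
  (\forall y \near x, f y = g y) -> differentiable f x -> differentiable g x.
Proof.
by move=> fg df; case: (near_is_diff fg (differentiableP df)).
Qed.

(** In the standard basis a linear map is a finite sum of coordinate functions times fixed
    vectors. *)
Lemma linear_rV_continuous n (W : normedModType R) (f : {linear 'rV[R]_n -> W}) :
  continuous f.
Proof.
have -> : (f : _ -> W) =
    \sum_(j < n) (fun v : 'rV[R]_n => (v 0 j : R) *: f (delta_mx 0 j)).
  apply/funext => v; rewrite fct_sumE [in LHS](row_sum_delta v) linear_sum /=.
  by apply: eq_bigr => j _; rewrite linearZ.
move=> v; apply: differentiable_continuous; apply: differentiable_sum => j.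
by apply: differentiableZl; exact: differentiable_coord.
Qed.

Lemma is_diff_linear_rV n (W : normedModType R) (f : {linear 'rV[R]_n -> W})
    (x : 'rV[R]_n) :
  is_diff x f f.
Proof.
apply: DiffDef; first exact/linear_differentiable/linear_rV_continuous.
by rewrite diff_lin //; exact: linear_rV_continuous.
Qed.

Lemma is_diff_lsubmx m n (x : 'rV[R]_(m + n)) :
  is_diff x (lsubmx : 'rV[R]_(m + n) -> 'rV[R]_m) lsubmx.
Proof. exact: is_diff_linear_rV. Qed.

Lemma is_diff_rsubmx m n (x : 'rV[R]_(m + n)) :
  is_diff x (rsubmx : 'rV[R]_(m + n) -> 'rV[R]_n) rsubmx.
Proof. exact: is_diff_linear_rV. Qed.

Lemma is_diff_row_mx (V : normedModType R) m n (f df : V -> 'rV[R]_m)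
    (g dg : V -> 'rV[R]_n) (x : V) :
  is_diff x f df -> is_diff x g dg ->
  is_diff x (fun y => row_mx (f y) (g y)) (fun v => row_mx (df v) (dg v)).
Proof.
move=> fdf gdg.
(* Concatenation is a sum of two linear maps, so sum and composition rules apply. *)
have rmE (a : 'rV[R]_m) (b : 'rV[R]_n) :
    row_mx a b = mulmxr (row_mx 1%:M 0) a + mulmxr (row_mx 0 1%:M) b.
  by rewrite /= !mul_mx_row !mulmx1 !mulmx0 add_row_mx addr0 add0r.
have -> : (fun y => row_mx (f y) (g y)) =
    (mulmxr (row_mx 1%:M 0) \o f) + (mulmxr (row_mx 0 1%:M) \o g).
  by apply/funext => y; rewrite rmE.
have -> : (fun y => row_mx (df y) (dg y)) =
    (mulmxr (row_mx 1%:M 0) \o df) + (mulmxr (row_mx 0 1%:M) \o dg).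
  by apply/funext => y; rewrite rmE.
by apply: is_diffD; apply: is_diff_comp; exact: is_diff_linear_rV.
Qed.

Lemma differentiable_rowP (V : normedModType R) n (f : V -> 'rV[R]_n) (x : V) :
  (forall j, differentiable (fun y => f y 0 j : R) x) -> differentiable f x.
Proof.
move=> df.
have -> : f = \sum_(j < n) (fun y => (f y 0 j : R) *: delta_mx 0 j).
  by apply/funext => y; rewrite fct_sumE [in LHS](row_sum_delta (f y)).
by apply: differentiable_sum => j; apply: differentiableZl.
Qed.

Lemma dotv_row_mx m n (a c : 'rV[R]_m) (b d : 'rV[R]_n) :
  dotv (row_mx a b) (row_mx c d) = dotv a c + dotv b d.
Proof.
rewrite /dotv big_split_ord /=; congr (_ + _); apply: eq_bigr => j _.
  by rewrite !row_mxEl.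
by rewrite !row_mxEr.
Qed.

Lemma dotv_mxE n (u v : 'rV[R]_n) : dotv u v = (u *m v^T) 0 0.
Proof. by rewrite mxE; apply: eq_bigr => j _; rewrite mxE. Qed.

Lemma dotvC n (u v : 'rV[R]_n) : dotv u v = dotv v u.
Proof. by apply: eq_bigr => j _; rewrite mulrC. Qed.

Lemma dotvDl n (u v w : 'rV[R]_n) : dotv (u + v) w = dotv u w + dotv v w.
Proof. by rewrite !dotv_mxE mulmxDl mxE. Qed.

Lemma dotvZl n a (u v : 'rV[R]_n) : dotv (a *: u) v = a * dotv u v.
Proof. by rewrite !dotv_mxE -scalemxAl mxE. Qed.

Lemma dotv0l n (v : 'rV[R]_n) : dotv 0 v = 0.
Proof. by rewrite dotv_mxE mul0mx mxE. Qed.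

Lemma dotv_deltar n (u : 'rV[R]_n) j : dotv u (delta_mx 0 j) = u 0 j.
Proof.
rewrite /dotv (bigD1 j) //= mxE !eqxx mulr1 big1 ?addr0 // => l lj.
by rewrite mxE (negbTE lj) andbF mulr0.
Qed.

Lemma dotv_inj n (u v : 'rV[R]_n) : (forall w, dotv u w = dotv v w) -> u = v.
Proof. by move=> uv; apply/rowP => j; rewrite -!dotv_deltar uv. Qed.

Lemma linear_dotv n (f : {linear 'rV[R]_n -> R}) v :
  f v = dotv (\row_j f (delta_mx 0 j)) v.
Proof.
rewrite [in LHS](row_sum_delta v) linear_sum; apply: eq_bigr => j _.
by rewrite linearZ mxE mulrC.
Qed.

(** The row vector on the left is the transpose of f applied to p, that is, the covector p pulled
    back along f. *)
Lemma dotv_linearr m n (p : 'rV[R]_n) (f : {linear 'rV[R]_m -> 'rV[R]_n}) v :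
  dotv (\row_j dotv p (f (delta_mx 0 j))) v = dotv p (f v).
Proof.
rewrite [in RHS](row_sum_delta v) linear_sum dotvC [in RHS]dotv_mxE linear_sum.
rewrite mulmx_sumr summxE; apply: eq_bigr => j _.
by rewrite linearZ mxE linearZ /= -scalemxAr mxE dotv_mxE.
Qed.

Lemma diff_dotv_grad n (F : 'rV[R]_n -> R) (y v : 'rV[R]_n) :
  'd (F : 'rV[R]_n -> R^o) y v = dotv (grad F y) v.
Proof.
exact: (linear_dotv ('d (F : 'rV[R]_n -> R^o) y : {linear 'rV[R]_n -> R})).
Qed.

End Calculus.

(** * Functions read in a chart, and change of chart *)

Section ChartCalculus.
Context {R : realType}.

Definition chart_inj T n (c : chart R T n) :=
  forall x y, cdom c x -> cdom c y -> cmap c x = cmap c y -> x = y.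

(** Injectivity of the chart leaves [xget] a single value to choose. *)
Lemma in_chartE T n (c : chart R T n) (V : normedModType R) (f : T -> V) x :
  chart_inj c -> cdom c x -> in_chart c f (cmap c x) = f x.
Proof.
move=> cI cx; rewrite /in_chart; case: xgetP => [v _ [z [cz zx] <-]|/(_ (f x))].
  by rewrite (cI z x).
by case; exists x.
Qed.

(** The first-order part of [smooth_transition]: enough for the chain rule, and easier to carry over
    to products and to the cotangent bundle. *)
Definition differentiable_transition T n (c d : chart R T n) :=
  open (cmap c @` (cdom c `&` cdom d)) /\
  forall x, cdom c x -> cdom d x ->
    differentiable (in_chart c (cmap d)) (cmap c x).

Lemma smooth_differentiable_transition T n (c d : chart R T n) :
  smooth_transition c d -> differentiable_transition c d.
Proof.
move=> [cdo cds]; split=> // x cx dx.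
by have [+ _] := cds 1; apply; exists x.
Qed.

Lemma in_chart_change T n (c d : chart R T n) (V : normedModType R)
    (f : T -> V) x :
  chart_inj c -> chart_inj d -> open (cmap c @` (cdom c `&` cdom d)) ->
  cdom c x -> cdom d x ->
  \forall y \near cmap c x, in_chart d f (in_chart c (cmap d) y) = in_chart c f y.
Proof.
move=> cI dI cdo cx dx.
have : nbhs (cmap c x) (cmap c @` (cdom c `&` cdom d)).
  by apply: open_nbhs_nbhs; split=> //; exists x.
apply: filterS => _ [z [cz dz] <-].
by rewrite !in_chartE.
Qed.

Lemma is_diff_in_chart_change T n (c d : chart R T n) (V : normedModType R)
    (f : T -> V) x :
  chart_inj c -> chart_inj d -> differentiable_transition c d ->
  cdom c x -> cdom d x -> differentiable (in_chart d f) (cmap d x) ->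
  is_diff (cmap c x) (in_chart c f)
    ('d (in_chart d f) (cmap d x) \o 'd (in_chart c (cmap d)) (cmap c x)).
Proof.
move=> cI dI [cdo cdd] cx dx df.
have := in_chart_change f cI dI cdo cx dx; move/near_is_diff; apply.
apply: is_diff_comp; first exact/differentiableP/cdd.
by rewrite in_chartE //; exact: differentiableP.
Qed.

End ChartCalculus.

(** * Transformation laws of tangent vectors and covectors *)

Section Atlases.
Context {R : realType}.

Definition differentiable_atlas n (M : charted R n) :=
  (forall i : cidx M, is_chart (atlas i)) /\
  (forall i j : cidx M, differentiable_transition (atlas i) (atlas j)).

Lemma manifold_differentiable_atlas n (M : charted R n) :
  manifold M -> differentiable_atlas M.
Proof.
by case=> Mc _ Ms _ _; split=> // i j; exact/smooth_differentiable_transition.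
Qed.

(** The cocycle identity, as the chain rule for the transition from i to k through j. *)
Lemma transition_comp n (M : charted R n) (i j k : cidx M) x v :
  differentiable_atlas M ->
  cdom (atlas i) x -> cdom (atlas j) x -> cdom (atlas k) x ->
  'd (in_chart (atlas j) (cmap (atlas k))) (cmap (atlas j) x)
    ('d (in_chart (atlas i) (cmap (atlas j))) (cmap (atlas i) x) v) =
  'd (in_chart (atlas i) (cmap (atlas k))) (cmap (atlas i) x) v.
Proof.
move=> [Mc Mt] ix jx kx.
have H := is_diff_in_chart_change (f := cmap (atlas k)) (Mc i).1 (Mc j).1
  (Mt i j) ix jx ((Mt j k).2 _ jx kx).
by rewrite [RHS](is_diffE v H).
Qed.

Lemma transition_id n (M : charted R n) (i : cidx M) x v :
  differentiable_atlas M -> cdom (atlas i) x ->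
  'd (in_chart (atlas i) (cmap (atlas i))) (cmap (atlas i) x) v = v.
Proof.
move=> [Mc Mt] ix.
suff H : is_diff (cmap (atlas i) x) (in_chart (atlas i) (cmap (atlas i))) id.
  by rewrite diff_val.
apply: (@near_is_diff _ _ _ id).
have : nbhs (cmap (atlas i) x) (cran (atlas i)).
  by apply: open_nbhs_nbhs; split; [exact: (Mc i).2|exists x].
by apply: filterS => _ [z iz <-]; rewrite in_chartE //; exact: (Mc i).1.
Qed.

Lemma tangent_transition n (M : charted R n) (W : tangent M) i j :
  cdom (atlas i) (tbase W) -> cdom (atlas j) (tbase W) ->
  tcomp W j =
  'd (in_chart (atlas i) (cmap (atlas j))) (cmap (atlas i) (tbase W)) (tcomp W i).
Proof. by case: W => x c c0 cT /=; exact: cT. Qed.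

Lemma covector_transition n (M : charted R n) (a : covector M) i j v :
  cdom (atlas i) (cbase a) -> cdom (atlas j) (cbase a) ->
  dotv (ccomp a i) v = dotv (ccomp a j)
    ('d (in_chart (atlas i) (cmap (atlas j))) (cmap (atlas i) (cbase a)) v).
Proof. by case: a => x c c0 cT /= ix jx; exact: cT. Qed.

(** The transformation law dictates the components in every other chart around x; the cocycle
    identity makes these compatible with one another. *)
Lemma tangent_exists n (M : charted R n) (i : cidx M) x v :
  differentiable_atlas M -> cdom (atlas i) x ->
  exists2 W : tangent M, tbase W = x & tcomp W i = v.
Proof.
move=> Md ix.
(* The value 0 off the chart domain is the one demanded by the record [tangent]. *)
pose c j := if pselect (cdom (atlas j) x) then
  'd (in_chart (atlas i) (cmap (atlas j))) (cmap (atlas i) x) v else 0.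
have c0 j : ~ cdom (atlas j) x -> c j = 0 by rewrite /c; case: pselect.
have cE j : cdom (atlas j) x -> c j =
    'd (in_chart (atlas i) (cmap (atlas j))) (cmap (atlas i) x) v.
  by rewrite /c; case: pselect.
clearbody c.
have cT j l : cdom (atlas j) x -> cdom (atlas l) x ->
    c l = 'd (in_chart (atlas j) (cmap (atlas l))) (cmap (atlas j) x) (c j).
  by move=> jx lx; rewrite (cE _ lx) (cE _ jx); apply/esym/transition_comp.
by exists (Tangent c0 cT) => //=; rewrite cE // (transition_id _ Md ix).
Qed.

(** Dual construction: covectors pull back, so [pull j] goes from chart j to chart i and its
    transpose is applied to p. *)
Lemma covector_exists n (M : charted R n) (i : cidx M) x p :
  differentiable_atlas M -> cdom (atlas i) x ->
  exists2 a : covector M, cbase a = x & ccomp a i = p.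
Proof.
move=> Md ix.
pose pull j : {linear 'rV[R]_n -> 'rV[R]_n} :=
  'd (in_chart (atlas j) (cmap (atlas i))) (cmap (atlas j) x).
pose c j := if pselect (cdom (atlas j) x) then
  \row_l dotv p (pull j (delta_mx 0 l)) else 0.
have c0 j : ~ cdom (atlas j) x -> c j = 0 by rewrite /c; case: pselect.
have cE j v : cdom (atlas j) x -> dotv (c j) v = dotv p (pull j v).
  by rewrite /c; case: pselect => //= _ _; exact: dotv_linearr.
clearbody c.
have cT j l : cdom (atlas j) x -> cdom (atlas l) x -> forall v,
    dotv (c j) v = dotv (c l)
      ('d (in_chart (atlas j) (cmap (atlas l))) (cmap (atlas j) x) v).
  move=> jx lx v. rewrite (cE _ _ lx). rewrite (cE _ _ jx).
  congr (dotv p _).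
  rewrite /pull.
  apply/esym.
  exact: (transition_comp v Md jx lx ix).
exists (Covector c0 cT) => //=; apply: dotv_inj => v.
by rewrite cE // /pull (transition_id _ Md ix).
Qed.

(** Components are 0 outside the chart domains and determined by chart i inside them; the proof
    fields agree by proof irrelevance. This yields injectivity of the cotangent charts. *)
Lemma covector_inj n (M : charted R n) (i : cidx M) (a b : covector M) :
  cbase a = cbase b -> cdom (atlas i) (cbase a) -> ccomp a i = ccomp b i ->
  a = b.
Proof.
move=> ab ia abi.
have cab : ccomp a = ccomp b.
  apply/funext => j; have [ja|ja] := pselect (cdom (atlas j) (cbase a)).
    apply: dotv_inj => v.
    by rewrite (covector_transition _ ja ia) abi ab -covector_transition -?ab.
  case: a b ab {abi ia} ja => [x c c0 cT] [y d d0 dT] /= xy jx.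
  by rewrite c0 // d0 // -xy.
case: a b ab cab {ia abi} => [x c c0 cT] [y d d0 dT] /= xy cd.
case: y / xy d0 dT => d0 dT; case: d / cd d0 dT => d0 dT.
by congr Covector; exact: Prop_irrelevance.
Qed.

(** Both sides of the defining identity obey the transformation laws of M and N, so one pair of
    charts decides it for all pairs. *)
Lemma tangent_map_chart m n (M : charted R m) (N : charted R n) (f : M -> N)
    (V : tangent M) (W : tangent N) i k :
  differentiable_atlas M -> differentiable_atlas N ->
  cdom (atlas i) (tbase V) -> tbase W = f (tbase V) ->
  (forall x, cdom (atlas i) x -> cdom (atlas k) (f x)) ->
  differentiable (in_chart (atlas i) (cmap (atlas k) \o f))
    (cmap (atlas i) (tbase V)) ->
  tcomp W k = 'd (in_chart (atlas i) (cmap (atlas k) \o f))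
                (cmap (atlas i) (tbase V)) (tcomp V i) ->
  tangent_map f V W.
Proof.
move=> Md Nd iV WfV ik fd Wk; split=> // i' j i'V jfV.
have [[Mc Mt] [Nc Nt]] := (Md, Nd).
have kfV := ik _ iV.
(* Change of chart in the target: the representative into chart j factors through chart k. *)
have fjd : is_diff (cmap (atlas i) (tbase V))
    (in_chart (atlas i) (cmap (atlas j) \o f))
    ('d (in_chart (atlas k) (cmap (atlas j))) (cmap (atlas k) (f (tbase V))) \o
     'd (in_chart (atlas i) (cmap (atlas k) \o f)) (cmap (atlas i) (tbase V))).
  have fE : \forall y \near cmap (atlas i) (tbase V),
      (in_chart (atlas k) (cmap (atlas j)) \o
       in_chart (atlas i) (cmap (atlas k) \o f)) y =
      in_chart (atlas i) (cmap (atlas j) \o f) y.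
    have : nbhs (cmap (atlas i) (tbase V)) (cran (atlas i)).
      by apply: open_nbhs_nbhs; split; [exact: (Mc i).2|exists (tbase V)].
    apply: filterS => _ [z iz <-] /=.
    rewrite /= (in_chartE (cmap (atlas k) \o f) (Mc i).1 iz) /=.
    by rewrite (in_chartE _ (Nc k).1 (ik _ iz)) (in_chartE _ (Mc i).1 iz).
  apply: (near_is_diff fE); apply: is_diff_comp; first exact: differentiableP.
  rewrite (in_chartE _ (Mc i).1 iV) /=.
  by apply: differentiableP; exact: (Nt k j).2.
(* Change of chart in the source, from i' to i. *)
have fi'd := is_diff_in_chart_change (Mc i').1 (Mc i).1 (Mt i' i) i'V iV
  (ex_diff (is_diff_def := fjd)).
have e1 := is_diffE (tcomp V i') fi'd.
have e2 := is_diffE (tcomp V i) fjd.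
apply: etrans (esym e1); rewrite -[RHS]/('d _ _ ('d _ _ _)).
rewrite -(tangent_transition i'V iV); apply: etrans (esym e2).
rewrite -[RHS]/('d _ _ ('d _ _ _)) -Wk -WfV.
by apply: tangent_transition; rewrite WfV.
Qed.

End Atlases.

(** * Differentiable atlases of products, of the line and of the cotangent bundle *)

Section ProductAndCotangentAtlases.
Context {R : realType}.

Lemma open_row_block m n (A : set 'rV[R]_m) (B : set 'rV[R]_n) :
  open A -> open B ->
  open [set y : 'rV[R]_(m + n) | A (lsubmx y) /\ B (rsubmx y)].
Proof.
move=> oA oB.
have -> : [set y : 'rV[R]_(m + n) | A (lsubmx y) /\ B (rsubmx y)] =
  (lsubmx @^-1` A) `&` (rsubmx @^-1` B) by [].
apply: openI; apply: open_comp => // y _.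
  exact: continuous_lsubmx.
exact: continuous_rsubmx.
Qed.

Lemma image_prod_chart T U m n (c : chart R T m) (d : chart R U n)
    (A : set T) (B : set U) :
  cmap (prod_chart c d) @` (A `*` B) =
  [set y | (cmap c @` A) (lsubmx y) /\ (cmap d @` B) (rsubmx y)].
Proof.
apply/seteqP; split=> y /=.
  move=> [[a b] [/= Aa Bb] <-] /=; rewrite row_mxKl row_mxKr.
  by split; [exists a|exists b].
move=> [[a Aa ay] [b Bb bY]]; exists (a, b) => //=.
by rewrite ay bY hsubmxK.
Qed.

Lemma prod_chart_inj T U m n (c : chart R T m) (d : chart R U n) :
  chart_inj c -> chart_inj d -> chart_inj (prod_chart c d).
Proof.
move=> cI dI [a b] [a' b'] [/= ca db] [/= ca' db'] /eq_row_mx [aa bb].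
by rewrite (cI a a') // (dI b b').
Qed.

Lemma is_chart_prod T U m n (c : chart R T m) (d : chart R U n) :
  is_chart c -> is_chart d -> is_chart (prod_chart c d).
Proof.
move=> [cI cO] [dI dO]; split; first exact: prod_chart_inj.
by rewrite /cran image_prod_chart; exact: open_row_block.
Qed.

(** On the overlap, itself a product, the transition acts separately on the two blocks. *)
Lemma differentiable_transition_prod T U m n (c c' : chart R T m)
    (d d' : chart R U n) :
  chart_inj c -> chart_inj d ->
  differentiable_transition c c' -> differentiable_transition d d' ->
  differentiable_transition (prod_chart c d) (prod_chart c' d').
Proof.
move=> cI dI [cO cD] [dO dD].
have overlapE : cdom (prod_chart c d) `&` cdom (prod_chart c' d') =
    (cdom c `&` cdom c') `*` (cdom d `&` cdom d').
  by apply/seteqP; split=> -[a b] /= [] [? ?] [? ?].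
set overlap := cdom (prod_chart c d) `&` cdom (prod_chart c' d').
have oO : open (cmap (prod_chart c d) @` overlap).
  by rewrite /overlap overlapE image_prod_chart; exact: open_row_block.
split=> // x xc xc'.
have [[ca db] [ca' db']] := (xc, xc').
set y := cmap _ x.
have yl : lsubmx y = cmap c x.1 by rewrite /y /= row_mxKl.
have yr : rsubmx y = cmap d x.2 by rewrite /y /= row_mxKr.
have H : is_diff y
    (fun y => row_mx ((in_chart c (cmap c') \o lsubmx) y)
                     ((in_chart d (cmap d') \o rsubmx) y))
    (fun v => row_mx (('d (in_chart c (cmap c')) (lsubmx y) \o lsubmx) v)
                     (('d (in_chart d (cmap d')) (rsubmx y) \o rsubmx) v)).
  apply: is_diff_row_mx; apply: is_diff_comp.
  - exact: is_diff_lsubmx.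
  - by apply: differentiableP; rewrite yl; exact: cD.
  - exact: is_diff_rsubmx.
  - by apply: differentiableP; rewrite yr; exact: dD.
apply: near_differentiable (ex_diff (is_diff_def := H)).
have : nbhs y (cmap (prod_chart c d) @` overlap).
  by apply: open_nbhs_nbhs; split=> //; exists x.
apply: filterS => _ [z [zc zc'] <-]; rewrite in_chartE //; last exact: prod_chart_inj.
have [zc1 zc2] := zc.
by rewrite /= row_mxKl row_mxKr !in_chartE.
Qed.

Lemma prodM_differentiable_atlas m n (M : charted R m) (N : charted R n) :
  differentiable_atlas M -> differentiable_atlas N ->
  differentiable_atlas (prodM M N).
Proof.
move=> [Mc Mt] [Nc Nt]; split=> [[i j]|[i j] [i' j']] /=.
  exact: is_chart_prod.
by apply: differentiable_transition_prod => //; [exact: (Mc i).1|exact: (Nc j).1].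
Qed.

Lemma const_mx11 (y : 'rV[R]_1) : const_mx (y 0 0) = y.
Proof. by apply/rowP => j; rewrite mxE ord1. Qed.

Lemma lineM_differentiable_atlas : differentiable_atlas (@lineM R).
Proof.
have lineI i : chart_inj (atlas (c := @lineM R) i).
  by move=> x y _ _ /= /rowP /(_ 0); rewrite !mxE.
have lineT i : cmap (atlas (c := @lineM R) i) @` setT = setT.
  by apply/seteqP; split=> // y _; exists (y 0 0) => //=; rewrite const_mx11.
split=> [i|i j]; first by split; [exact: lineI|rewrite /cran lineT; exact: openT].
split; first by rewrite setIid lineT; exact: openT.
move=> x _ _.
have -> : in_chart (atlas i) (cmap (atlas j)) = idfun.
  apply/funext => y; rewrite -[in LHS](const_mx11 y) -[RHS]const_mx11.
  exact: (in_chartE (cmap (atlas j)) (lineI i) (I : cdom (atlas i) (y 0 0))).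
by case: (is_diff_id (cmap (atlas i) x)).
Qed.

(** The fibre part of a cotangent transition contains first derivatives of a transition of M, so one
    order of smoothness is lost; hence the hypothesis [manifold] instead of
    [differentiable_atlas]. *)
Lemma cotM_differentiable_atlas n (M : charted R n) :
  manifold M -> differentiable_atlas (cotM M).
Proof.
move=> Mm; have Md := manifold_differentiable_atlas Mm.
have [Mc Mt] := Md; have [_ _ Ms _ _] := Mm.
have cotI i : chart_inj (cot_chart i : chart R (covector M) (n + n)).
  move=> a b /= ia ib /eq_row_mx [ab abi].
  exact: covector_inj ((Mc i).1 _ _ ia ib ab) ia abi.
(* By [covector_exists] every fibre coordinate is attained, so openness reduces to openness in the
   base. *)
have cot_image (i : cidx M) (A : set M) : A `<=` cdom (atlas i) ->
    cmap (cot_chart i) @` (@cbase _ _ M @^-1` A) =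
    [set y | (cmap (atlas i) @` A) (lsubmx y) /\ setT (rsubmx y)].
  move=> Ai; apply/seteqP; split=> y /=.
    by move=> [a Aa <-]; rewrite row_mxKl; split=> //; exists (cbase a).
  move=> [[x Ax xy] _].
  have [a ax ap] := covector_exists (rsubmx y) Md (Ai _ Ax).
  by exists a; rewrite /= ?ax // ap xy hsubmxK.
suff : (forall i : cidx M,
      is_chart (cot_chart i : chart R (covector M) (n + n))) /\
    forall i j : cidx M, differentiable_transition
      (cot_chart i : chart R (covector M) (n + n)) (cot_chart j) by [].
split=> [i|i j].
  split; first exact: cotI.
  rewrite /cran [cdom _](_ : _ = @cbase _ _ M @^-1` cdom (atlas i)) // cot_image //.
  by apply: open_row_block; [exact: (Mc i).2|exact: openT].
set overlap := cdom (cot_chart i) `&` cdom (cot_chart j).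
have oO : open (cmap (cot_chart i) @` overlap).
  rewrite [overlap](_ : _ =
    @cbase _ _ M @^-1` (cdom (atlas i) `&` cdom (atlas j))) //.
  rewrite cot_image; last by move=> x [].
  by apply: open_row_block; [exact: (Mt i j).1|exact: openT].
split=> // a ia ja.
set y := cmap _ a.
have yl : lsubmx y = cmap (atlas i) (cbase a) by rewrite /y /= row_mxKl.
pose phi : 'rV[R]_n -> 'rV[R]_n := in_chart (atlas i) (cmap (atlas j)).
pose dpsi (q : 'rV[R]_n) : {linear 'rV[R]_n -> 'rV[R]_n} :=
  'd (in_chart (atlas j) (cmap (atlas i))) q.
(* Explicit cotangent transition: q goes to phi(q), and p to the transpose of d psi at phi(q)
   applied to p, with psi the inverse transition. *)
pose F (y : 'rV[R]_(n + n)) := row_mx (phi (lsubmx y))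
  (\row_l dotv (rsubmx y) (dpsi (phi (lsubmx y)) (delta_mx 0 l))).
have dphi : differentiable (phi \o lsubmx) y.
  apply: differentiable_comp; first exact: differentiable_lsubmx.
  by rewrite yl; exact: (Mt i j).2.
have phiE x : cdom (atlas i) x -> phi (cmap (atlas i) x) = cmap (atlas j) x.
  by move=> ix; rewrite /phi in_chartE //; exact: (Mc i).1.
have dF : differentiable F y.
  have H2 : differentiable (fun y : 'rV[R]_(n + n) =>
      (\row_l dotv (rsubmx y) (dpsi (phi (lsubmx y)) (delta_mx 0 l)) : 'rV[R]_n)) y.
    apply: differentiable_rowP => l.
    rewrite (_ : (fun _ => _) = \sum_(k < n)
        (fun y : 'rV[R]_(n + n) => (rsubmx y 0 k : R)) *
        (fun y => (dpsi (phi (lsubmx y)) (delta_mx 0 l) 0 k : R))); last first.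
      by apply/funext => z; rewrite mxE fct_sumE.
    apply: differentiable_sum => k; apply: differentiableM.
      apply: (differentiable_comp (g := fun v : 'rV[R]_n => v 0 k : R)).
        exact: differentiable_rsubmx.
      exact: differentiable_coord.
    apply: (differentiable_comp (f := fun y => dpsi (phi (lsubmx y)) (delta_mx 0 l))
       (g := fun v : 'rV[R]_n => v 0 k : R)); last exact: differentiable_coord.
    apply: (differentiable_comp (f := phi \o lsubmx)
       (g := fun q => dpsi q (delta_mx 0 l))) => //.
    (* Class C^2 of psi makes its derivative in the direction of a basis vector differentiable. *)
    have [_ /(_ 2) [_ /(_ (delta_mx 0 l)) [+ _]]] := Ms j i; apply.
    by exists (cbase a) => //=; rewrite yl phiE.
  by case: (is_diff_row_mx (differentiableP dphi) (differentiableP H2)).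
apply: near_differentiable dF.
have : nbhs y (cmap (cot_chart i) @` overlap).
  by apply: open_nbhs_nbhs; split=> //; exists a.
apply: filterS => _ [b [ib jb] <-]; rewrite (in_chartE _ (cotI i) ib).
rewrite /F /= row_mxKl row_mxKr phiE //; congr row_mx.
apply/rowP => l; rewrite mxE -dotv_deltar; apply/esym.
exact: covector_transition.
Qed.

End ProductAndCotangentAtlases.

(** * The section gamma and its tangent map in Darboux coordinates *)

Local Notation qz_chart i := (atlas (c := prodM _ lineM) (i, tt)).

Section Gamma.
Context {R : realType} {n : nat} (Q : charted R n) (g : Q -> covector Q).
Hypothesis Q_manifold : manifold Q.
Hypothesis g_form : one_form g.

Let Qd : differentiable_atlas Q := manifold_differentiable_atlas Q_manifold.

Definition gamma_local (i : cidx Q) (y : 'rV[R]_(n + 1)) : 'rV[R]_(n + n + 1) :=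
  row_mx (row_mx (lsubmx y) (local_form g i (lsubmx y))) (rsubmx y).

Definition dgamma_local (i : cidx Q) (y v : 'rV[R]_(n + 1)) :
    'rV[R]_(n + n + 1) :=
  row_mx (row_mx (lsubmx v) ('d (local_form g i) (lsubmx y) (lsubmx v)))
    (rsubmx v).

Lemma lift_gammaE k i (x : 'rV[R]_(n + 1 + k)) :
  lift_gamma g i x = row_mx (gamma_local i (lsubmx x)) (rsubmx x).
Proof. by []. Qed.

Lemma local_formE i q :
  cdom (atlas i) q -> local_form g i (cmap (atlas i) q) = ccomp (g q) i.
Proof. by move=> iq; rewrite /local_form in_chartE //; exact: (Qd.1 i).1. Qed.

(** Smoothness of g is stated for maps into T*Q; the fibre block of its representative in the
    cotangent chart of the same index i is [local_form g i]. *)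
Lemma differentiable_local_form i q :
  cdom (atlas i) q -> differentiable (local_form g i) (cmap (atlas i) q).
Proof.
move=> iq; have [gb gs] := g_form.
have igq : cdom (atlas (c := cotM Q) i) (g q) by rewrite /= gb.
have [D [oD Dq Dsub /(_ 1) [Dd _]]] := gs q I i i iq igq.
have := differentiable_comp (Dd _ Dq) (differentiable_rsubmx _).
apply: near_differentiable.
have : nbhs (cmap (atlas i) q) D by apply: open_nbhs_nbhs.
apply: filterS => _ /Dsub [z [iz _] <-].
by rewrite /= (in_chartE _ (Qd.1 i).1 iz) /= row_mxKr local_formE.
Qed.

Lemma is_diff_gamma_local i (y : 'rV[R]_(n + 1)) :
  differentiable (local_form g i) (lsubmx y) ->
  is_diff y (gamma_local i) (dgamma_local i y).
Proof.
move=> gd; apply: is_diff_row_mx; last exact: is_diff_rsubmx.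
apply: is_diff_row_mx; first exact: is_diff_lsubmx.
apply: (@is_diff_comp _ _ _ _ lsubmx lsubmx); first exact: is_diff_lsubmx.
exact: differentiableP.
Qed.

Lemma cmap_gamma i (x : prodM Q lineM) : cdom (atlas i) x.1 ->
  cmap (darboux i) (gamma g x) =
  gamma_local i (cmap (qz_chart i) x).
Proof.
by move=> ix; rewrite /gamma_local /= row_mxKl row_mxKr g_form.1 local_formE.
Qed.

Lemma is_diff_gamma i (x : prodM Q lineM) : cdom (atlas i) x.1 ->
  is_diff (cmap (qz_chart i) x)
    (in_chart (qz_chart i) (cmap (darboux i) \o gamma g))
    (dgamma_local i (cmap (qz_chart i) x)).
Proof.
move=> ix; have [Mc _] := prodM_differentiable_atlas Qd
  (lineM_differentiable_atlas (R := R)).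
have gl := @is_diff_gamma_local i (cmap (qz_chart i) x).
apply: near_is_diff (gl _); last first.
  by rewrite /= row_mxKl; exact: differentiable_local_form.
have : nbhs (cmap (qz_chart i) x)
    (cran (qz_chart i)).
  by apply: open_nbhs_nbhs; split; [exact: (Mc (i, tt)).2|exists x].
apply: filterS => _ [z iz <-].
by rewrite (in_chartE _ (Mc (i, tt)).1 iz) /comp cmap_gamma //; exact: iz.1.
Qed.

(** [gamma g] sends the whole domain of the (q, z) chart into that of the Darboux chart of the same
    index, so [tangent_map_chart] applies to this pair. *)
Lemma tangent_map_gammaP i (V : tangent (prodM Q lineM))
    (X : tangent (contactM Q)) :
  cdom (atlas i) (tbase V).1 ->
  tangent_map (gamma g) V X <->
  tbase X = gamma g (tbase V) /\
  tcomp X (i, tt) =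
    dgamma_local i (cmap (qz_chart i) (tbase V))
      (tcomp V (i, tt)).
Proof.
move=> iV; have gd := is_diff_gamma iV.
have gi (x : prodM Q lineM) : cdom (atlas i) x.1 ->
    cdom (darboux i) (gamma g x).
  by move=> ix; split=> //=; rewrite g_form.1.
have iV' : cdom (qz_chart i) (tbase V) by [].
split=> [[XV XE]|[XV XE]].
  split=> //; rewrite -(is_diffE _ gd).
  by apply: XE => //; exact: gi.
apply: (tangent_map_chart (i := (i, tt) : cidx (prodM Q lineM))
  (k := (i, tt) : cidx (contactM Q))) => //.
- exact: prodM_differentiable_atlas Qd (lineM_differentiable_atlas (R := R)).
- apply: prodM_differentiable_atlas; last exact: lineM_differentiable_atlas.
  exact: cotM_differentiable_atlas.
- by move=> x [ix _]; exact: gi.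
- by apply: etrans XE _; rewrite -(is_diffE _ gd).
Qed.

End Gamma.

(** * Critical points, the Hamilton-Jacobi equation in coordinates, and the equivalence *)

Section Main.
Context {R : realType} {n k : nat}.
Context (Q : charted R n) (P : charted R (n + n + 1 + k)).
Variables (tau : P -> contactM Q) (E : P -> R) (g : Q -> covector Q).
Hypothesis Q_manifold : manifold Q.
Hypothesis P_manifold : manifold P.
Hypothesis E_smooth : smooth_fun E.
Hypothesis g_form : one_form g.
Hypothesis g_closed : closed_form g.

Let Qd : differentiable_atlas Q := manifold_differentiable_atlas Q_manifold.

(** The chart c is only in the maximal atlas, so differentiability is transferred from an atlas
    chart around the point. *)
Lemma differentiable_localE (c : chart R P (n + n + 1 + k)) y :
  maximal_atlas c -> cran c y ->
  differentiable (localE E c : _ -> R^o) y.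
Proof.
move=> [[cI _] cT] [w cw <-].
have [Pc Pcov _ _ _] := P_manifold.
have [i iw] := Pcov w.
have [Ed _] := E_smooth i 1.
have := is_diff_in_chart_change (f := E : P -> R^o) cI (Pc i).1
  (smooth_differentiable_transition (cT i).1) cw iw.
by case; first by apply: Ed; exists w.
Qed.

Section Critical.
Variables (i : cidx Q) (c : chart R P (n + n + 1 + k)) (x : 'rV[R]_(n + 1 + k)).
Hypothesis x_crit : critical tau E g i c x.

Let y := lift_gamma g i x.
Let q := lsubmx (lsubmx x).

(** The lifted coordinates belong to a point of P, whose image under [tau] lies over the required
    point of Q. *)
Lemma critical_base : exists2 q0, cdom (atlas i) q0 & cmap (atlas i) q0 = q.
Proof.
have [[_ cb] [w cw wy] _] := x_crit.
have [[iw _] tw] := cb w cw.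
exists (cbase (tau w).1) => //.
move: tw; rewrite wy /qpzpart lift_gammaE row_mxKl.
move=> /eq_row_mx [/eq_row_mx [qE _] _].
exact: esym qE.
Qed.

(** Chain rule through [lift_gamma]: criticality kills the lambda-term, and closedness of g moves d
    gamma from the direction v onto E_p. *)
Lemma diff_pulled_E v :
  'd (pulled_E E g i c : 'rV[R]_(n + 1 + k) -> R^o) x v =
  dotv (partial_q (localE E c) y +
        'd (local_form g i) q (partial_p (localE E c) y))
    (lsubmx (lsubmx v)) +
  partial_z (localE E c) y * rsubmx (lsubmx v) 0 0.
Proof.
have [[cm _] cy yl] := x_crit; have [q0 iq0 q0E] := critical_base.
have dE := differentiable_localE cm cy.
have gd : differentiable (local_form g i) q.
  by rewrite -q0E; exact: differentiable_local_form.
have dl : is_diff x (lift_gamma g i)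
    (fun v => row_mx ((dgamma_local g i (lsubmx x) \o lsubmx) v) (rsubmx v)).
  apply: is_diff_row_mx; last exact: is_diff_rsubmx.
  apply: (@is_diff_comp _ _ _ _ lsubmx lsubmx (gamma_local g i)
    (dgamma_local g i (lsubmx x))); first exact: is_diff_lsubmx.
  exact: is_diff_gamma_local gd.
have dp : is_diff x (pulled_E E g i c : 'rV[R]_(n + 1 + k) -> R^o)
    ('d (localE E c : _ -> R^o) y \o
     (fun v => row_mx ((dgamma_local g i (lsubmx x) \o lsubmx) v) (rsubmx v))).
  by apply: is_diff_comp; exact: differentiableP.
rewrite (is_diffE v dp) /comp diff_dotv_grad.
rewrite -[grad _ y]hsubmxK -/(lpart _) -/(partial_l _ y) yl.
rewrite dotv_row_mx dotv0l addr0 -[lsubmx (grad _ _)]hsubmxK dotv_row_mx.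
rewrite -[lsubmx (lsubmx (grad _ _))]hsubmxK dotv_row_mx dotvDl.
congr (_ + _ + _).
  rewrite [LHS]dotvC; apply: (g_closed (i := i)).
  by exists q0.
by rewrite /dotv big_ord1.
Qed.

Lemma pulled_contact_formP :
  (forall v, 'd (pulled_E E g i c : 'rV[R]_(n + 1 + k) -> R^o) x v =
    pulled_contact_form E g i c x v) <->
  'd (local_form g i) q (partial_p (localE E c) y) =
  - partial_q (localE E c) y - partial_z (localE E c) y *: local_form g i q.
Proof.
set gq := local_form g i q.
have E1 v : pulled_contact_form E g i c x v =
    partial_z (localE E c) y * rsubmx (lsubmx v) 0 0 -
    partial_z (localE E c) y * dotv gq (lsubmx (lsubmx v)).
  by rewrite /pulled_contact_form /reeb mulrBr.
split=> [H|H v]; last first.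
  rewrite diff_pulled_E E1 H addrA addrN add0r -scaleNr dotvZl mulNr.
  by rewrite addrC.
apply: dotv_inj => w.
(* Directions with zero z- and lambda-blocks isolate the dq-component. *)
have := H (row_mx (row_mx w 0) 0).
rewrite diff_pulled_E E1 !row_mxKl row_mxKr mxE mulr0 addr0 sub0r dotvDl => H'.
apply: (addrI (dotv (partial_q (localE E c) y) w)).
rewrite H' dotvDl -[- partial_q _ _]scaleN1r -[- (_ *: gq)]scaleNr !dotvZl.
by rewrite mulN1r mulNr addrA addrN add0r.
Qed.

End Critical.

(** Turns the coordinates (q, z) into an actual point of Q x R, over which tangent vectors can be
    built. *)
Lemma critical_gamma i c x : critical tau E g i c x ->
  exists x0 : prodM Q lineM, [/\ cdom (atlas i) x0.1,
    cmap (qz_chart i) x0 = lsubmx x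
  & cmap (darboux i) (gamma g x0) = qpzpart (lift_gamma g i x)].
Proof.
move=> x_crit; have [q0 iq0 q0E] := critical_base x_crit.
pose x0 : prodM Q lineM := (q0, rsubmx (lsubmx x) 0 0).
have x0E : cmap (qz_chart i) x0 = lsubmx x.
  by rewrite /= q0E const_mx11 hsubmxK.
exists x0; split=> //.
by rewrite cmap_gamma // x0E /qpzpart lift_gammaE row_mxKl.
Qed.

Let Cd : differentiable_atlas (contactM Q) := prodM_differentiable_atlas
  (cotM_differentiable_atlas Q_manifold) (lineM_differentiable_atlas (R := R)).

Let Bd : differentiable_atlas (prodM Q lineM) := prodM_differentiable_atlas
  Qd (lineM_differentiable_atlas (R := R)).

Lemma ppart_lift_gamma i (x : 'rV[R]_(n + 1 + k)) :
  ppart (lift_gamma g i x) = local_form g i (lsubmx (lsubmx x)).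
Proof. by rewrite /ppart !row_mxKl row_mxKr. Qed.

(* The element of N_E over a critical point is some T gamma(V), whose
   p-components are d gamma applied to its own q-components; it does not matter
   over which lambda V was found. *)
Lemma legendrian_sub_image_pulled :
  legendrian_restr tau E g `<=` image_projected tau E g ->
  forall i c x, critical tau E g i c x ->
  forall v, 'd (pulled_E E g i c : 'rV[R]_(n + 1 + k) -> R^o) x v =
    pulled_contact_form E g i c x v.
Proof.
move=> sub i c x x_crit; apply/(pulled_contact_formP x_crit).
have [cb cy yl] := x_crit.
have [x0 [ix0 x0E gx0E]] := critical_gamma x_crit.
set y := lift_gamma g i x in cy yl gx0E *.
have igx0 : cdom (atlas (c := contactM Q) (i, tt)) (gamma g x0).
  by split=> //=; rewrite g_form.1.
have [X Xb XE] := tangent_exists (row_mx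
  (row_mx (partial_p (localE E c) y)
    (- partial_q (localE E c) y - partial_z (localE E c) y *: ppart y))
  (const_mx (dotv (ppart y) (partial_p (localE E c) y) - localE E c y))) Cd igx0.
have /sub : legendrian_restr tau E g (X, partial_z (localE E c) y).
  split; last by exists x0.
  by exists i, c, y; split=> //; split; rewrite //= Xb.
move=> [i' [c' [x' [V [_ _ _ gV _]]]]].
(* Since g is a section, [cbase] recovers q from the common base point of X and T gamma(V). *)
have Vx0 : (tbase V).1 = x0.1.
  have [XV _] := gV; move: XV; rewrite /= Xb => -[/(congr1 (@cbase _ _ Q))].
  by rewrite !g_form.1.
have iV : cdom (atlas i) (tbase V).1 by rewrite Vx0.
have [_] := (tangent_map_gammaP Q_manifold g_form X iV).1 gV.
have qE : lsubmx (cmap (qz_chart i) (tbase V)) =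
    lsubmx (lsubmx x).
  by rewrite -x0E /= !row_mxKl Vx0.
(* The q-blocks identify the q-velocity of V with E_p; the p-blocks then give the claim. *)
rewrite XE => /eq_row_mx [/eq_row_mx [<-]].
by rewrite qE ppart_lift_gamma => <-.
Qed.

(** The data (i, c, x) of V also serve for N_E: by the equation, d gamma(E_p) is the p-velocity
    prescribed there. *)
Lemma image_sub_legendrian :
  (forall i c x, critical tau E g i c x ->
   forall v, 'd (pulled_E E g i c : 'rV[R]_(n + 1 + k) -> R^o) x v =
    pulled_contact_form E g i c x v) ->
  image_projected tau E g `<=` legendrian_restr tau E g.
Proof.
move=> H [X u] [i [c [x [V [x_crit _ [Vi Vx VE] gV /= ->]]]]].
split; last by exists (tbase V); have [] := gV.
have dg := (pulled_contact_formP x_crit).1 (H _ _ _ x_crit).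
have [cb cy yl] := x_crit.
have [Xb XE] := (tangent_map_gammaP Q_manifold g_form X Vi.1).1 gV.
exists i, c, (lift_gamma g i x); split=> //; split.
- by rewrite /= Xb; split=> //=; rewrite g_form.1; exact: Vi.1.
- rewrite -[LHS]/(cmap (darboux i) (tbase X)) Xb cmap_gamma //; last exact: Vi.1.
  by rewrite Vx /qpzpart lift_gammaE row_mxKl.
- by rewrite /= XE VE Vx /dgamma_local row_mxKl row_mxKr dg ppart_lift_gamma.
Qed.

Lemma legendrian_sub_image :
  (forall i c x, critical tau E g i c x ->
   forall v, 'd (pulled_E E g i c : 'rV[R]_(n + 1 + k) -> R^o) x v =
    pulled_contact_form E g i c x v) ->
  legendrian_restr tau E g `<=` image_projected tau E g.
Proof.
move=> H [X u] [[i [c [y [cb cy yl [/= Xi Xy XE] /= ->]]]] [x0 Xb]].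
have ix0 : cdom (atlas i) x0.1.
  by case: Xi => /=; rewrite Xb /= g_form.1.
(* Dropping p from y loses nothing, since over im(gamma) it is determined by q. *)
pose x : 'rV[R]_(n + 1 + k) :=
  row_mx (cmap (qz_chart i) x0) (rsubmx y).
have yE : y = lift_gamma g i x.
  rewrite lift_gammaE row_mxKl row_mxKr -cmap_gamma //.
  by rewrite -[y in LHS]hsubmxK -Xb -[lsubmx y]Xy.
have x_crit : critical tau E g i c x by split; rewrite -?yE.
have xl : lsubmx (lsubmx x) = cmap (atlas i) x0.1.
  by rewrite row_mxKl /= row_mxKl.
have pE : ppart y = local_form g i (lsubmx (lsubmx x)).
  by rewrite yE ppart_lift_gamma.
have := (pulled_contact_formP x_crit).1 (H _ _ _ x_crit).
rewrite -yE => dg.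
(* V is the element of the projected set at x; [dg] then matches the p-block of T gamma(V) with that
   of X. *)
have [V Vb VE] := tangent_exists (row_mx (partial_p (localE E c) y)
  (const_mx (dotv (ppart y) (partial_p (localE E c) y) - localE E c y))) Bd
  (conj ix0 I : cdom (qz_chart i) x0).
have Vx : projected_at E g i c x V.
  by split; rewrite ?Vb -?yE // row_mxKl.
exists i, c, x, V; split; [exact: x_crit| |exact: Vx| |by rewrite -yE].
  by exists i, c, x.
apply/(tangent_map_gammaP Q_manifold g_form (i := i)); first by rewrite Vb.
split; first by rewrite Vb.
by rewrite XE VE Vb /dgamma_local !row_mxKl !row_mxKr pE -dg xl.
Qed.

End Main.

Theorem theorem3p3 (R : realType) (n k : nat)
    (Q : charted R n) (P : charted R (n + n + 1 + k))
    (tau : P -> contactM Q) (E : P -> R) (g : Q -> covector Q)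
    (Q_manifold : manifold Q)
    (tau_bundle : fiber_bundle tau)
    (E_morse : morse_family tau E)
    (g_form : one_form g)
    (g_closed : closed_form g) :
  gamma_related tau E g <->
  (forall (i : cidx Q) (c : chart R P (n + n + 1 + k)) (x : 'rV[R]_(n + 1 + k)),
     critical tau E g i c x ->
     forall v : 'rV[R]_(n + 1 + k),
       'd (pulled_E E g i c : 'rV[R]_(n + 1 + k) -> R^o) x v =
       pulled_contact_form E g i c x v).
Proof.
have [P_manifold _ _ _] := tau_bundle; have [E_smooth _] := E_morse.
split=> [related|H].
  by apply: legendrian_sub_image_pulled => //; rewrite -related.
apply/seteqP; split; first exact: image_sub_legendrian.
exact: legendrian_sub_image.
Qed.
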